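(* For every integer $c\ge2$, there exists an instance (a set of agents, a set of goods, and bivalued additive valuations with values in $\{1,c\}$ for the agents) in which no leximin allocation is EF1.
   Context: $N=\{1,\dots,n\}$ is a set of agents and $G$ a finite set of goods; agent $i$ has valuation $v_i:2^G\to\mathbb{R}_{\ge0}$. A bivalued additive valuation (with values $1,c$) is one with $v_i(S)=\sum_{g\in S}v_i(\{g\})$ for all $S\subseteq G$ and $v_i(\{g\})\in\{1,c\}$ for all $g\in G$. An allocation $X=(X_0,X_1,\dots,X_n)$ is a partition of $G$ into $n+1$ (possibly empty) bundles; $X_i$ goes to agent $i\in N$ and $X_0$ is the set of unallocated goods. The sorted utility vector $\vec s^X$ is $(v_1(X_1),\dots,v_n(X_n))$ sorted in ascending order. $X$ is leximin if there is no allocation $Y$ and index $k\in[n]$ with $s^Y_j=s^X_j$ for all $j<k$ and $s^Y_k>s^X_k$. $X$ is EF1 (envy free up to one good) if for all agents $i,j\in N$ with $X_j\neq\emptyset$ there is a good $g\in X_j$ with $v_i(X_i)\ge v_i(X_j\setminus\{g\})$. *)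

(* Defs.v *)
From mathcomp Require Import all_boot all_order all_algebra.
From mathcomp Require Import reals.

Set Implicit Arguments.
Unset Strict Implicit.
Unset Printing Implicit Defensive.

Import Order.TTheory GRing.Theory Num.Theory.
Local Open Scope ring_scope.

Definition additive_valuation (R : realType) (G : finType)
    (v : {set G} -> R) : Prop :=
  forall S : {set G}, v S = \sum_(g in S) v [set g].

Definition bivalued_additive (R : realType) (G : finType) (a b : R)
    (v : {set G} -> R) : Prop :=
  [/\ forall S : {set G}, 0 <= v S,
      additive_valuation v
    & forall g : G, v [set g] = a \/ v [set g] = b].

(* An allocation is a family (X_0, X_1, ..., X_n) of possibly empty bundles.
   X ord0 is the set of unallocated goods; agents are numbered from 0, so
   agent i : 'I_n receives the bundle of index i + 1. *)
Definition allocation (n : nat) (G : finType) (X : 'I_n.+1 -> {set G}) : Prop :=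
  \bigcup_i X i = [set: G] /\
  forall i j : 'I_n.+1, i != j -> [disjoint X i & X j].

Definition bundle (n : nat) (G : finType) (X : 'I_n.+1 -> {set G})
    (i : 'I_n) : {set G} :=
  X (lift ord0 i).

Definition sorted_utility (R : realType) (n : nat) (G : finType)
    (v : 'I_n -> {set G} -> R) (X : 'I_n.+1 -> {set G}) : seq R :=
  sort <=%R [seq v i (bundle X i) | i <- enum 'I_n].

(* Positions in the sorted vector are numbered from 0 as well. *)
Definition leximin (R : realType) (n : nat) (G : finType)
    (v : 'I_n -> {set G} -> R) (X : 'I_n.+1 -> {set G}) : Prop :=
  allocation X /\
  ~ exists (Y : 'I_n.+1 -> {set G}) (k : 'I_n),
      [/\ allocation Y,
          forall j : 'I_n, (j < k)%N ->
            (sorted_utility v Y)`_j = (sorted_utility v X)`_j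
        & (sorted_utility v X)`_k < (sorted_utility v Y)`_k].

Definition EF1 (R : realType) (n : nat) (G : finType)
    (v : 'I_n -> {set G} -> R) (X : 'I_n.+1 -> {set G}) : Prop :=
  forall i j : 'I_n, bundle X j != set0 ->
    exists2 g : G, g \in bundle X j &
      v i (bundle X j :\ g) <= v i (bundle X i).

(* Main.v *)
(* Two agents and 2c + 2 identical goods, each worth c to the first agent and 1
   to the second: leximin equalizes the utilities at 2c, giving 2 goods to the
   first agent and 2c to the second. The first agent then values the other
   bundle minus one good at c(2c - 1) > 2c. *)
Require Import Defs.
From mathcomp Require Import all_boot all_order all_algebra.
From mathcomp Require Import reals zify.

Set Implicit Arguments.
Unset Strict Implicit.
Unset Printing Implicit Defensive.

Import Order.TTheory GRing.Theory Num.Theory.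
Local Open Scope ring_scope.

(** The product is taken in [nat] before the cast, so that [ler_nat] turns comparisons of utilities
    into comparisons of cardinalities. *)
Definition card_valuation (R : realType) (G : finType) (w : nat)
    (S : {set G}) : R := (w * #|S|)%:R.

Lemma bivalued_card_valuation (R : realType) (G : finType) (a b w : nat) :
  w = a \/ w = b -> bivalued_additive a%:R b%:R (@card_valuation R G w).
Proof.
move=> w_ab; split=> [S|S|g]; rewrite /card_valuation.
- exact: ler0n.
- under eq_bigr => g _ do rewrite cards1 muln1.
  by rewrite sumr_const natrM mulr_natr.
- by rewrite cards1 muln1; case: w_ab => ->; [left | right].
Qed.

Lemma sorted_utility2_0 (R : realType) (G : finType)
    (v : 'I_2 -> {set G} -> R) (X : 'I_3 -> {set G}) :
  (sorted_utility v X)`_0 =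
  Num.min (v ord0 (bundle X ord0)) (v ord_max (bundle X ord_max)).
Proof.
rewrite /sorted_utility !enum_ordSl enum_ord0 /=.
rewrite (_ : lift ord0 ord0 = ord_max); last exact: val_inj.
by rewrite /sort /= minEle; case: ifP.
Qed.

(** Entry 0 of the sorted vector is the minimum utility. If it were below [x] for [X], then [Y]
    would beat [X] at [k = 0], where no earlier entries have to agree. *)
Lemma leximin2_min (R : realType) (G : finType) (v : 'I_2 -> {set G} -> R)
    (X Y : 'I_3 -> {set G}) (x : R) :
  leximin v X -> allocation Y ->
  (forall i, x <= v i (bundle Y i)) -> forall i, x <= v i (bundle X i).
Proof.
move=> [_ Xmax] Yalloc Yx.
suff: x <= Num.min (v ord0 (bundle X ord0)) (v ord_max (bundle X ord_max)).
  rewrite le_min => /andP[x0 x1] i.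
  have [->//|->//] : i = ord0 \/ i = ord_max.
  by case: i => [[|[|i]] // lti]; [left | right]; apply: val_inj.
rewrite leNgt; apply/negP => ltx; apply: Xmax; exists Y, ord0; split=> //.
by rewrite !sorted_utility2_0 (lt_le_trans ltx)// le_min !Yx.
Qed.

(** Indices 1 and 2 are the bundles of agents [ord0] and [ord_max]; index 0 is never hit, so no good
    stays unallocated. *)
Definition split_allocation (k m : nat) (j : 'I_3) : {set 'I_(k + m)} :=
  [set g : 'I_(k + m) | j == (if (g < k)%N then 1 else 2) :> nat].

Lemma split_allocationP (k m : nat) : allocation (@split_allocation k m).
Proof.
split=> [|i j].
- apply/setP=> g; rewrite inE; apply/bigcupP.
  exists (inord (if (g < k)%N then 1 else 2)) => //.
  by rewrite inE inordK //; case: ifP.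
- apply: contraNT => /pred0Pn[g] /andP[]; rewrite !inE => /eqP gi /eqP gj.
  by apply/eqP/val_inj; rewrite /= gi gj.
Qed.

Lemma card_split_allocation1 (k m : nat) :
  #|bundle (@split_allocation k m) ord0| = k.
Proof.
rewrite -[RHS](card_ord k) -[RHS](card_imset _ (@lshift_inj k m)).
apply: eq_card => g; rewrite inE /=; apply/idP/imsetP => [|[h _ ->]].
- by case: ltnP => // ltgk _; exists (Ordinal ltgk) => //; apply: val_inj.
- by rewrite /= ltn_ord.
Qed.

Lemma card_split_allocation2 (k m : nat) :
  #|bundle (@split_allocation k m) ord_max| = m.
Proof.
(* As every good is allocated, the second bundle is the complement of the first. *)
have := cardsC (bundle (@split_allocation k m) ord0).
rewrite card_split_allocation1 card_ord => /addnI cardC; rewrite -[RHS]cardC.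
by apply: eq_card => g; rewrite !inE /=; case: ifP.
Qed.

(** The two bundles are disjoint; equality can fail because of unallocated goods. *)
Lemma card_bundles_le (G : finType) (X : 'I_3 -> {set G}) :
  allocation X -> (#|bundle X ord0| + #|bundle X ord_max| <= #|G|)%N.
Proof.
move=> [_ dX]; have /leqifP := leq_card_setU (bundle X ord0) (bundle X ord_max).
rewrite dX // => /eqP <-; exact: max_card.
Qed.

Theorem proposition8p2 (R : realType) (c : nat) (hc : (2 <= c)%N) :
  exists (n : nat) (G : finType) (v : 'I_n -> {set G} -> R),
    (forall i : 'I_n, bivalued_additive 1 c%:R (v i)) /\
    forall X : 'I_n.+1 -> {set G}, leximin v X -> ~ EF1 v X.
Proof.
pose G : finType := 'I_(2 + 2 * c).
pose w (i : 'I_2) := if i == ord0 then c else 1%N.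
exists 2%N, G, (fun i => @card_valuation R G (w i)); split=> [i|X Xlex Xef].
  apply: (@bivalued_card_valuation _ _ 1); rewrite /w.
  by case: eqP; [right | left].
(* Compare with the split into 2 and [2 * c] goods, worth exactly [2 * c] to each owner. *)
have Xge : forall i, (2 * c)%:R <= card_valuation R (w i) (bundle X i).
  apply: (leximin2_min Xlex (@split_allocationP 2 (2 * c))) => i.
  rewrite /card_valuation ler_nat.
  case: i => [[|[|i]] // lti]; rewrite /w /=.
  - rewrite (_ : Ordinal lti = ord0) ?card_split_allocation1 1?mulnC //.
    exact: val_inj.
  - rewrite (_ : Ordinal lti = ord_max) ?card_split_allocation2 ?mul1n //.
    exact: val_inj.
have c_gt0 : (0 < c)%N by apply: ltnW.
have := Xge ord0; rewrite /card_valuation ler_nat mulnC leq_pmul2l // => c1.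
have := Xge ord_max; rewrite /card_valuation ler_nat mul1n => c2.
(* The lower bounds 2 and [2 * c] already add up to the number of goods, so both are attained. *)
have := card_bundles_le Xlex.1; rewrite card_ord => cardX.
have [|g gX] := Xef ord0 ord_max; first by rewrite -card_gt0; lia.
(* After cancelling the factor [c], EF1 says [2 * c - 1 <= 2], which fails since [2 <= c]. *)
rewrite /card_valuation ler_nat leq_pmul2l //.
have := cardsD1 g (bundle X ord_max); rewrite gX; lia.
Qed.
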